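(* Compare the retail prices $p_{R_1}^{(5)},p_{R_2}^{(5)}$ of Model V with the retail prices $p_{R_1}^{(4)},p_{R_2}^{(4)}$ of Model IV, all defined in the context. The condition on $k$ for retailer one's price is $$k<K_1:=\frac{\left[2-(p_m+c_m+c_r+c_d-c)^2\right]fe_0}{c_m+c_r+c_d-c},$$ and the condition on $k$ for retailer two's price is $$k<K_2:=\frac{3fe_0}{c_m+c_r+c_d-c}-\frac{fe_0(p_m+c_m+c_r+c_d-c)^2}{\beta_H(a-\varepsilon)(c_m+c_r+c_d-c)}+\varepsilon .$$ That is, for $i=1,2$, no matter whether retailer one's fixed cost is high or low: only if the unit degree $k$ of reward and penalty reaches a certain level, namely $K_i$, is retailer $i$'s price lower in Model V than in Model IV ($p_{R_i}^{(5)}<p_{R_i}^{(4)}$); on the contrary, when $k<K_i$, retailer $i$'s price is larger in Model V than in Model IV ($p_{R_i}^{(5)}>p_{R_i}^{(4)}$).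
   Context: A manufacturer sells new products through two competing retailers. Retailer one recycles waste products and has private information about its recycling: its recycling difficulty coefficient is either high, $\beta_H$ (with high fixed cost), or low, $\beta_L$ (with low fixed cost); the manufacturer only knows the distribution, the low type having probability $\mu$ and the high type $1-\mu$. Parameters: $a$ is the potential market demand; $\varepsilon$ is the substitute coefficient, $0<\varepsilon<1$; retailer $i$ with price $p_i$ faces demand $a-p_i+\varepsilon p_j$ ($j\ne i$); $c$ is retailer one's unit cost of a recycled product; $c_d$ is the manufacturer's unit testing and sorting cost; $c_r$ is its unit remanufacturing cost; $c_m$ is its unit cost of a new product; $p_m$ is its unit price to the retailers; $e_m$ is its unit carbon emission; $e_0$ is the government's carbon emission upper limit; $f$ is the unit degree of government reward and penalty for carbon emission; $k$ is the unit degree of government reward and penalty for recycling. Model IV is the decentralized model with competing retailers and the carbon emission constraint; Model V is the decentralized model with competing retailers, the carbon emission constraint and, in addition, the government's reward-penalty mechanism for recycling. Write $A=p_m+c_m+c_r+c_d-c$, $A'=p_m+c_m+c_r-c$, $B=c_m+c_r+c_d-c$, and $$P_1=\frac{\mu(2+\varepsilon)(a-\varepsilon)\left[2\beta_H+A^2\right]+(a+\varepsilon)(1-\mu)(4+\varepsilon)\left[2\beta_L-A^2\right]}{4\beta_H-(a-\varepsilon)A^2+4\beta_L-\varepsilon^2},$$ $$P_2=\frac{\mu(a-\varepsilon)(6+\varepsilon)\left[4\beta_H^2-2A'^2\right]+(a+\varepsilon)(1-\mu)(8+2\varepsilon)\left[4\beta_L^2-2A'^2\right]}{4\beta_H-(a-\varepsilon)A^2+4\beta_L-\varepsilon^2}.$$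 The retail prices of retailers one and two in the two models are $$p_{R_1}^{(4)}=P_1+\frac{fe_m}{4\beta_H+(a-\varepsilon)A^2}+fe_0,\qquad p_{R_2}^{(4)}=P_2+\frac{fe_m}{(a-\varepsilon)A^2}+\frac{fe_0}{\beta_H(a-\varepsilon)},$$ $$p_{R_1}^{(5)}=P_1+\frac{fe_m}{4\beta_H+(a-\varepsilon)A^2}+\frac{2fe_0-Bk}{A^2},\qquad p_{R_2}^{(5)}=P_2+\frac{fe_m}{(a-\varepsilon)A^2}+\frac{3fe_0-B(k-\varepsilon)}{A^2}.$$
   Formalization: The formal theorem adds the assumption c_m+c_r+c_d-c > 0; without it K_1 and K_2 are undefined (value zero) or both price comparisons are reversed (negative value). *)

(* Defs.v *)
From mathcomp Require Import all_boot all_order all_algebra.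
Set Implicit Arguments.
Unset Strict Implicit.
Unset Printing Implicit Defensive.
Import Order.TTheory GRing.Theory Num.Theory.
Local Open Scope ring_scope.

(** Parameters common to Model IV and Model V.  The recycling reward-penalty
    degree [k] is not one of them: it exists only in Model V. *)
Record market (R : realFieldType) := Market {
  a : R;        (* potential market demand *)
  eps : R;      (* substitute coefficient *)
  mu : R;       (* probability of the low recycling type *)
  beta_H : R;   (* recycling difficulty coefficient, high type *)
  beta_L : R;   (* recycling difficulty coefficient, low type *)
  c : R;        (* retailer one's unit cost of a recycled product *)
  c_d : R;      (* manufacturer's unit testing and sorting cost *)
  c_r : R;      (* manufacturer's unit remanufacturing cost *)
  c_m : R;      (* manufacturer's unit cost of a new product *)
  p_m : R;      (* manufacturer's unit price to the retailers *)
  e_m : R;      (* manufacturer's unit carbon emission *)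
  e_0 : R;      (* carbon emission upper limit *)
  f : R         (* unit reward-penalty degree for carbon emission *)
}.

Section Prices.
Variables (R : realFieldType) (M : market R).

Definition A : R := p_m M + c_m M + c_r M + c_d M - c M.
Definition A' : R := p_m M + c_m M + c_r M - c M.
Definition B : R := c_m M + c_r M + c_d M - c M.

Definition denP : R :=
  4 * beta_H M - (a M - eps M) * A ^+ 2 + 4 * beta_L M - eps M ^+ 2.

Definition P1 : R :=
  (mu M * (2 + eps M) * (a M - eps M) * (2 * beta_H M + A ^+ 2)
   + (a M + eps M) * (1 - mu M) * (4 + eps M) * (2 * beta_L M - A ^+ 2))
  / denP.

Definition P2 : R :=
  (mu M * (a M - eps M) * (6 + eps M) * (4 * beta_H M ^+ 2 - 2 * A' ^+ 2)
   + (a M + eps M) * (1 - mu M) * (8 + 2 * eps M)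
     * (4 * beta_L M ^+ 2 - 2 * A' ^+ 2))
  / denP.

(** The manufacturer only knows the distribution of retailer one's type, so
    each price is a single formula, valid whichever type is realized. *)
Definition price1_IV : R :=
  P1 + f M * e_m M / (4 * beta_H M + (a M - eps M) * A ^+ 2) + f M * e_0 M.

Definition price2_IV : R :=
  P2 + f M * e_m M / ((a M - eps M) * A ^+ 2)
  + f M * e_0 M / (beta_H M * (a M - eps M)).

Definition price1_V (k : R) : R :=
  P1 + f M * e_m M / (4 * beta_H M + (a M - eps M) * A ^+ 2)
  + (2 * f M * e_0 M - B * k) / A ^+ 2.

Definition price2_V (k : R) : R :=
  P2 + f M * e_m M / ((a M - eps M) * A ^+ 2)
  + (3 * f M * e_0 M - B * (k - eps M)) / A ^+ 2.

Definition K1 : R := (2 - A ^+ 2) * f M * e_0 M / B.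

Definition K2 : R :=
  3 * f M * e_0 M / B
  - f M * e_0 M * A ^+ 2 / (beta_H M * (a M - eps M) * B)
  + eps M.

(** All denominators occurring in the prices are nonzero; division by zero is
    otherwise a junk value.  [A != 0] follows from the third conjunct. *)
Definition prices_defined : Prop :=
  [/\ denP != 0,
      4 * beta_H M + (a M - eps M) * A ^+ 2 != 0,
      (a M - eps M) * A ^+ 2 != 0
    & beta_H M * (a M - eps M) != 0].

End Prices.

(* Main.v *)
Require Import Defs.
From mathcomp Require Import all_boot all_order all_algebra.
From mathcomp Require Import ring.
Import Order.TTheory GRing.Theory Num.Theory.
Local Open Scope ring_scope.

(** The two models share the common term [P1] (resp. [P2]) and the first
    emission term, so these cancel in the difference of the prices.  What is
    left is affine in [k] with slope [- B / A ^+ 2], and the threshold [K1]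
    (resp. [K2]) is exactly its root:
      [price_V k - price_IV = B / A ^+ 2 * (K - k)]
    ([price1_V_sub_IV], [price2_V_sub_IV]).  Since [B / A ^+ 2] is positive,
    the sign of the price difference is that of [K - k], which gives both
    directions of the comparison ([compare_of_sub]). *)

Lemma compare_of_sub (R : realFieldType) (s x y K k : R) :
  0 < s -> x - y = s * (K - k) ->
  (x < y <-> K < k) /\ (k < K -> x > y).
Proof.
move=> s_gt0 xyE.
have ltE : (x < y) = (K < k).
  by rewrite -subr_lt0 xyE pmulr_rlt0 // subr_lt0.
have gtE : (y < x) = (k < K).
  by rewrite -subr_gt0 xyE pmulr_rgt0 // subr_gt0.
by rewrite ltE gtE.
Qed.

Section PriceDifferences.
Variables (R : realFieldType) (M : market R) (k : R).
Hypotheses (A_neq0 : A M != 0) (B_neq0 : B M != 0).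

Lemma price1_V_sub_IV :
  price1_V M k - price1_IV M = B M / A M ^+ 2 * (K1 M - k).
Proof.
rewrite /price1_V /price1_IV /K1.
(* [A], [B] and the shared terms are made atoms, so that [field] asks only for
   the denominators that survive the cancellation. *)
move: (A M) (B M) A_neq0 B_neq0 (P1 M) (f M * e_m M / _) => A B A0 B0 P E.
by field; rewrite A0 B0.
Qed.

Lemma price2_V_sub_IV : beta_H M != 0 -> a M - eps M != 0 ->
  price2_V M k - price2_IV M = B M / A M ^+ 2 * (K2 M - k).
Proof.
rewrite /price2_V /price2_IV /K2.
move: (A M) (B M) A_neq0 B_neq0 (P2 M) (f M * e_m M / _).
move=> A B A0 B0 P E bH0 ae0.
by field; rewrite A0 B0 bH0 ae0.
Qed.

End PriceDifferences.

Theorem proposition8 (R : realFieldType) (M : market R) (k : R)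
    (heps : 0 < eps M < 1)
    (hmu : 0 <= mu M <= 1)
    (hbeta : beta_L M < beta_H M)
    (hdef : prices_defined M)
    (hB : 0 < B M) :
  ((price1_V M k < price1_IV M <-> K1 M < k) /\
   (k < K1 M -> price1_V M k > price1_IV M)) /\
  ((price2_V M k < price2_IV M <-> K2 M < k) /\
   (k < K2 M -> price2_V M k > price2_IV M)).
Proof.
case: hdef => _ _.
rewrite !mulf_eq0 !negb_or => /andP[_ /andP[A_neq0 _]] /andP[bH_neq0 ae_neq0].
have B_neq0 : B M != 0 by rewrite gt_eqF.
have slope_gt0 : 0 < B M / A M ^+ 2.
  by rewrite divr_gt0 // exprn_even_gt0.
split; apply: (compare_of_sub _ _ _ _ _ _ slope_gt0).
- exact: price1_V_sub_IV.
- exact: price2_V_sub_IV.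
Qed.
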